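(* Let $R,S,T,P$ be real numbers with $R>T>P$ and $R>S>P$, and let $0\le\gamma<1$. Every tie-free symmetric solution $Q$ of the Bellman optimality equation for the repeated harmony game (memory-1 strategies, discount factor $\gamma$) is one of the following three functions. (i) (All-C) For all $a,b\in\{C,D\}$, $$Q((a,b),C)=\frac{R}{1-\gamma},\qquad Q((a,b),D)=T+\frac{\gamma}{1-\gamma}R .$$ (ii) (Win-stay Lose-shift, WSLS) $$Q((C,C),C)=Q((D,D),C)=\frac{R}{1-\gamma},\qquad Q((C,C),D)=Q((D,D),D)=T+\gamma P+\frac{\gamma^2}{1-\gamma}R,$$ $$Q((C,D),C)=Q((D,C),C)=S+\gamma P+\frac{\gamma^2}{1-\gamma}R,\qquad Q((C,D),D)=Q((D,C),D)=P+\frac{\gamma}{1-\gamma}R .$$ (iii) (Frequent Handshake, FH) $$Q((D,D),C)=\frac{R+\gamma P}{1-\gamma^2},\qquad Q((D,D),D)=T+\frac{\gamma}{1-\gamma^2}(P+\gamma R),$$ $$Q((C,C),C)=Q((C,D),C)=Q((D,C),C)=S+\frac{\gamma}{1-\gamma^2}(P+\gamma R),$$ $$Q((C,C),D)=Q((C,D),D)=Q((D,C),D)=\frac{P+\gamma R}{1-\gamma^2}.$$ Moreover: - The function in (i) is always a tie-free symmetric solution, and for it $Q((a,b),C)>Q((a,b),D)$ for all $a,b$. - The function in (ii) is a tie-free symmetric solution with $Q((C,C),C)>Q((C,C),D)$, $Q((C,D),C)<Q((C,D),D)$, $Q((D,C),C)<Q((D,C),D)$, $Q((D,D),C)>Q((D,D),D)$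 if and only if $\gamma>\frac{S-P}{R-P}$. - The function in (iii) is a tie-free symmetric solution with $Q((C,C),C)<Q((C,C),D)$, $Q((C,D),C)<Q((C,D),D)$, $Q((D,C),C)<Q((D,C),D)$, $Q((D,D),C)>Q((D,D),D)$ if and only if $\gamma>\frac{S-P}{R-S}$.
   Context: Two agents A and B repeatedly and simultaneously choose actions in $\{C,D\}$. Agent A's reward $r(a,b)$ when A plays $a$ and B plays $b$ is $r(C,C)=R$, $r(C,D)=S$, $r(D,C)=T$, $r(D,D)=P$; agent B's reward is $r(b,a)$. Harmony game means $R>T>P$ and $R>S>P$. Agents use memory-1 greedy strategies: the state is the previous joint action $(a_0,b_0)$, with A's action first. The Bellman optimality equations for Q-functions $Q_A,Q_B$ are $$Q_A((a_0,b_0),a_1)=r_A(a_1,\tilde b_1)+\gamma\max_{a_2}Q_A((a_1,\tilde b_1),a_2),$$ $$Q_B((a_0,b_0),b_1)=r_B(\tilde a_1,b_1)+\gamma\max_{b_2}Q_B((\tilde a_1,b_1),b_2),$$ where $\tilde a_1=\operatorname{argmax}_{a}Q_A((a_0,b_0),a)$ and $\tilde b_1=\operatorname{argmax}_{b}Q_B((a_0,b_0),b)$. A solution is symmetric if $Q_A((a_0,b_0),a)=Q_B((b_0,a_0),a)$ for all $a_0,b_0,a$. Writing $Q=Q_A$, this reduces to the following definition. A tie-free symmetric solution is a function $Q:\{C,D\}^2\times\{C,D\}\to\mathbb{R}$ such that $Q((a,b),C)\ne Q((a,b),D)$ for all $a,b\in\{C,D\}$ and, for all $a_0,b_0,a_1\in\{C,D\}$,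 $$Q((a_0,b_0),a_1)=r(a_1,\tilde b)+\gamma\max_{a_2\in\{C,D\}}Q((a_1,\tilde b),a_2),\qquad \tilde b=\operatorname{argmax}_{b\in\{C,D\}}Q((b_0,a_0),b).$$ *)

(* Defs.v *)
From HB Require Import structures.
From mathcomp Require Import all_boot all_order all_algebra.
From mathcomp Require Import reals.
Set Implicit Arguments.
Unset Strict Implicit.
Unset Printing Implicit Defensive.
Import Order.TTheory GRing.Theory Num.Theory.
Local Open Scope ring_scope.

Inductive action := C | D.

Definition bool_of_action (a : action) : bool := if a is C then true else false.
Definition action_of_bool (b : bool) : action := if b then C else D.
Lemma bool_of_actionK : cancel bool_of_action action_of_bool.
Proof. by case. Qed.

HB.instance Definition _ := Finite.copy action (can_type bool_of_actionK).

(* The state is the previous joint action, the agent's own action first. *)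
Definition state : Type := (action * action)%type.

Definition reward (K : realType) (R S T P : K) (a b : action) : K :=
  match a, b with
  | C, C => R
  | C, D => S
  | D, C => T
  | D, D => P
  end.

(* In case of a tie [arg max] returns one of the two maximisers; this choice is
   immaterial below, since argmax is only used alongside [tie_free]. *)
Definition argmax (K : realType) (f : action -> K) : action :=
  [arg max_(a > C) f a]%O.

Definition tie_free (K : realType) (Q : state -> action -> K) : Prop :=
  forall a b : action, Q (a, b) C <> Q (a, b) D.

(* By symmetry the co-player's Q-function at (a0, b0) is Q at (b0, a0). *)
Definition bellman (K : realType) (R S T P gamma : K)
    (Q : state -> action -> K) : Prop :=
  forall a0 b0 a1 : action,
    let b1 := argmax (Q (b0, a0)) in
    Q (a0, b0) a1 =
      reward R S T P a1 b1 + gamma * Num.max (Q (a1, b1) C) (Q (a1, b1) D).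

Definition tie_free_symmetric_solution (K : realType) (R S T P gamma : K)
    (Q : state -> action -> K) : Prop :=
  tie_free Q /\ bellman R S T P gamma Q.

Definition Q_allC (K : realType) (R S T P gamma : K) (s : state) (a : action) : K :=
  match a with
  | C => R / (1 - gamma)
  | D => T + gamma / (1 - gamma) * R
  end.

Definition Q_WSLS (K : realType) (R S T P gamma : K) (s : state) (a : action) : K :=
  match s, a with
  | (C, C), C | (D, D), C => R / (1 - gamma)
  | (C, C), D | (D, D), D => T + gamma * P + gamma ^+ 2 / (1 - gamma) * R
  | (C, D), C | (D, C), C => S + gamma * P + gamma ^+ 2 / (1 - gamma) * R
  | (C, D), D | (D, C), D => P + gamma / (1 - gamma) * R
  end.

Definition Q_FH (K : realType) (R S T P gamma : K) (s : state) (a : action) : K :=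
  match s, a with
  | (D, D), C => (R + gamma * P) / (1 - gamma ^+ 2)
  | (D, D), D => T + gamma / (1 - gamma ^+ 2) * (P + gamma * R)
  | (C, C), C | (C, D), C | (D, C), C =>
      S + gamma / (1 - gamma ^+ 2) * (P + gamma * R)
  | (C, C), D | (C, D), D | (D, C), D =>
      (P + gamma * R) / (1 - gamma ^+ 2)
  end.

(* Main.v *)
(** Write [sigma s] for the greedy action in state [s]. The Bellman equation
    makes [Q (a, b)] depend on the state only through the co-player's action
    [sigma (b, a)]: [Q (a, b) = q (sigma (b, a))] for two functions [q C] and
    [q D] on actions. Hence [sigma (a, b)] is the best reply to [sigma (b, a)],
    and on the diagonal [sigma (a, a)] is a best reply to itself, which forces
    [sigma] to be symmetric. If [D] is ever played, then [D] is the best reply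
    to [D], and as [S > P] this requires the continuation value of [(D, D)] to
    exceed that of [(C, D)]: so [sigma (D, D) <> sigma (C, D)]. The values rule
    out [sigma (D, D) = D], and [sigma (C, C)] separates the two solutions with
    [sigma (D, D) = C] and [sigma (C, D) = D]. *)
Require Import Defs.
From HB Require Import structures.
From mathcomp Require Import all_boot all_order all_algebra.
From mathcomp Require Import reals.
From mathcomp Require Import ring lra.
Set Implicit Arguments.
Unset Strict Implicit.
Import Order.TTheory GRing.Theory Num.Theory.
Local Open Scope ring_scope.

(** * Greedy policies and the Bellman equation *)

Definition other (a : action) : action := if a is C then D else C.

(** Strictness builds in tie-freeness and lets [sigma] be given explicitly instead of through
    [argmax]. *)
Definition greedy (K : realType) (Q : state -> action -> K)
    (sigma : state -> action) : Prop :=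
  forall s, Q s (other (sigma s)) < Q s (sigma s).

Lemma argmax_ge (K : realType) (f : action -> K) (a : action) :
  f a <= f (argmax f).
Proof. by rewrite /argmax; case: arg_maxP => // i _; apply. Qed.

Lemma argmax_unique (K : realType) (f : action -> K) (a : action) :
  f (other a) < f a -> argmax f = a.
Proof.
by have := argmax_ge f a; case: (argmax f) a => -[] //= le lt;
  have := le_lt_trans le lt; rewrite ltxx.
Qed.

Lemma greedy_argmax (K : realType) (Q : state -> action -> K) :
  tie_free Q -> greedy Q (fun s => argmax (Q s)).
Proof.
move=> tf [a b]; rewrite lt_neqAle argmax_ge andbT; apply/eqP.
by case: (argmax _) => //= /esym; apply: tf.
Qed.

Lemma greedy_tie_free (K : realType) (Q : state -> action -> K) sigma :
  greedy Q sigma -> tie_free Q.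
Proof.
by move=> gr a b; have := gr (a, b); case: (sigma _) => /= + E; rewrite E ltxx.
Qed.

(** A known greedy policy replaces both the maximum and [argmax]; for fixed [sigma] the equations
    are linear in the values of [Q]. *)
Lemma greedy_bellman (K : realType) (R S T P gamma : K)
    (Q : state -> action -> K) (sigma : state -> action) :
  greedy Q sigma ->
  (bellman R S T P gamma Q <-> forall a0 b0 a1,
     let b1 := sigma (b0, a0) in
     Q (a0, b0) a1 =
       reward R S T P a1 b1 + gamma * Q (a1, b1) (sigma (a1, b1))).
Proof.
move=> gr.
have maxE s : Num.max (Q s C) (Q s D) = Q s (sigma s).
  by have := gr s; case: (sigma s) => /= /ltW ?; [apply: max_l|apply: max_r].
by split=> E a0 b0 a1 /=; rewrite E /= maxE (argmax_unique (gr _)).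
Qed.

(** * Discounted values of constant and alternating play *)

Section ClosedForms.
Context {K : realType} {R P gamma : K}.
Hypotheses (hgamma0 : 0 <= gamma) (hgamma1 : gamma < 1).

Lemma subr1_neq0 : 1 - gamma != 0.
Proof. by rewrite gt_eqF // subr_gt0. Qed.

Lemma subr1_sqr_neq0 : 1 - gamma ^+ 2 != 0.
Proof. by rewrite gt_eqF // subr_gt0 expr_lt1. Qed.

Lemma geometric_rec : R / (1 - gamma) = R + gamma * (R / (1 - gamma)).
Proof. by field; exact: subr1_neq0. Qed.

Lemma geometric_unique (u : K) : u = R + gamma * u -> u = R / (1 - gamma).
Proof.
by move=> uE; apply: (canRL (mulfK subr1_neq0)); rewrite mulrBr {1}uE; ring.
Qed.

Lemma alternating_rec :
  (P + gamma * R) / (1 - gamma ^+ 2) =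
    P + gamma * ((R + gamma * P) / (1 - gamma ^+ 2)).
Proof. by field; exact: subr1_sqr_neq0. Qed.

(** [u] is the value of the reward stream R, P, R, P, ...; exchanging [R] and [P] gives the value
    [w] of the stream starting with P. *)
Lemma alternating_unique (u w : K) :
  u = R + gamma * w -> w = P + gamma * u ->
  u = (R + gamma * P) / (1 - gamma ^+ 2).
Proof.
move=> uE wE; apply: (canRL (mulfK subr1_sqr_neq0)).
by rewrite mulrBr mulr1 {1}uE {1}wE; ring.
Qed.

End ClosedForms.

Section Solutions.
Context {K : realType} {R S T P gamma : K}.
Implicit Types (u w : K) (Q : state -> action -> K).

(** The three solutions in recursive form: [u] and [w] are [q C C] and [q D D], the
    optimal values against a co-player who is about to play [C], resp. [D]. *)
Definition allC_of u : state -> action -> K :=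
  fun _ a => if a is C then u else T + gamma * u.

Definition WSLS_of u : state -> action -> K := fun s a =>
  let w := P + gamma * u in
  match s, a with
  | (C, C), C | (D, D), C => u
  | (C, C), D | (D, D), D => T + gamma * w
  | _, C => S + gamma * w
  | _, D => w
  end.

Definition FH_of u w : state -> action -> K := fun s a =>
  match s, a with
  | (D, D), C => u
  | (D, D), D => T + gamma * w
  | _, C => S + gamma * w
  | _, D => w
  end.

Hypotheses (hgamma0 : 0 <= gamma) (hgamma1 : gamma < 1).

Lemma Q_allCE : Q_allC R S T P gamma =2 allC_of (R / (1 - gamma)).
Proof. by move=> s [] //=; field; exact: subr1_neq0. Qed.

Lemma Q_WSLSE : Q_WSLS R S T P gamma =2 WSLS_of (R / (1 - gamma)).
Proof. by move=> [[] []] [] //=; field; exact: subr1_neq0. Qed.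

Lemma Q_FHE :
  Q_FH R S T P gamma =2 FH_of ((R + gamma * P) / (1 - gamma ^+ 2))
                              ((P + gamma * R) / (1 - gamma ^+ 2)).
Proof. by move=> [[] []] [] //=; field; exact: subr1_sqr_neq0. Qed.

End Solutions.
Arguments Q_allCE {K} R S T P {gamma}.
Arguments allC_of {K} T gamma u.
Arguments Q_WSLSE {K} R S T P {gamma}.
Arguments WSLS_of {K} S T P gamma u.
Arguments Q_FHE {K} R S T P {gamma}.
Arguments FH_of {K} S T gamma u w.

(** * Classification by greedy policy *)

Lemma solution_cases (K : realType) (R S T P gamma : K)
    (hRT : T < R) (hTP : P < T) (hRS : S < R) (hSP : P < S)
    (hgamma0 : 0 <= gamma) (hgamma1 : gamma < 1) (Q : state -> action -> K) :
  tie_free_symmetric_solution R S T P gamma Q ->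
  [\/ exists2 u, u = R + gamma * u & Q =2 allC_of T gamma u,
      exists2 u, u = R + gamma * u & Q =2 WSLS_of S T P gamma u |
      exists u w, [/\ u = R + gamma * w, w = P + gamma * u &
                      Q =2 FH_of S T gamma u w]].
Proof.
move=> [/greedy_argmax]; set sigma := fun s => _ => gr.
rewrite (greedy_bellman _ _ _ _ _ gr) => E.
move: (gr (C, C)) (gr (C, D)) (gr (D, C)) (gr (D, D)).
move: (E C C C) (E C C D) (E C D C) (E C D D)
      (E D C C) (E D C D) (E D D C) (E D D D) => /=.
case sCC: (sigma (C, C)); case sCD: (sigma (C, D));
case sDC: (sigma (D, C)); case sDD: (sigma (D, D));
rewrite /= ?sCC ?sCD ?sDC ?sDD => E1 E2 E3 E4 E5 E6 E7 E8 gCC gCD gDC gDD.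
(* If [sigma (C, D)] and [sigma (D, C)] differed, they would be best replies to each other; but one
   of them equals [sigma (C, C)], the best reply to itself. *)
all: try by exfalso; lra.
(* The symmetric [sigma] remain, in lexicographic order of
   [(sigma (C, C), sigma (C, D), sigma (D, D))]. *)
- constructor 1; exists (Q (C, C) C) => //.
  have e : Q (D, C) C = Q (C, C) C by lra.
  by rewrite e in E2 E4 E6 E8; move=> [[] []] [] /=; lra.
- exfalso.
  have e : Q (C, D) C = Q (C, C) C by lra.
  (* Both states are absorbing, so the values are P / (1 - gamma) and R / (1 - gamma). *)
  have lt_v : Q (D, D) D < Q (C, C) C by nra.
  by have := ler_wpM2l hgamma0 (ltW lt_v); rewrite e in E7; lra.
- constructor 2; exists (Q (C, C) C) => //.
  have e : Q (D, D) C = Q (C, C) C by lra.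
  have eCD : Q (C, D) D = P + gamma * Q (C, C) C by rewrite -e.
  have eDC : Q (D, C) D = P + gamma * Q (C, C) C by rewrite -e.
  by rewrite eCD eDC in E2 E3 E5 E8; move=> [[] []] [] /=; lra.
- exfalso.
  (* Against [D], both replies have the same continuation value, so S > P makes [C] the better one;
     likewise in the next and the last case. *)
  have e : Q (C, D) D = Q (D, D) D by lra.
  by rewrite e in E7; lra.
- exfalso.
  have e : Q (C, D) C = Q (D, D) C by lra.
  by rewrite e in E1; lra.
- exfalso.
  have e : Q (C, C) D = Q (D, D) D by lra.
  have lt_v : Q (D, D) D < Q (C, D) C by rewrite e in E3; lra.
  by have := ler_wpM2l hgamma0 (ltW lt_v); lra.
- constructor 3; exists (Q (D, D) C), (Q (C, C) D).
  have eCD : Q (C, D) D = Q (C, C) D by lra.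
  have eDC : Q (D, C) D = Q (C, C) D by lra.
  by rewrite eCD eDC in E1 E3 E5 E7 E8; split=> // -[[] []] [] /=; lra.
- exfalso.
  have e : Q (C, D) D = Q (D, D) D by lra.
  by rewrite e in E7; lra.
Qed.

(** * Existence and thresholds *)

Lemma Q_allC_solution (K : realType) (R S T P gamma : K)
    (hRT : T < R) (hgamma1 : gamma < 1) :
  let Q := Q_allC R S T P gamma in
  tie_free_symmetric_solution R S T P gamma Q /\
  forall a b, Q (a, b) C > Q (a, b) D.
Proof.
move=> Q; have QE : Q =2 _ := Q_allCE R S T P hgamma1.
move: Q QE => Q QE.
have uE := geometric_rec (R := R) hgamma1.
have lt_Q a b : Q (a, b) D < Q (a, b) C.
  by rewrite !QE /=; lra.
have gr : greedy Q (fun=> C) by case.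
split=> //; split; first exact: greedy_tie_free gr.
apply/(greedy_bellman _ _ _ _ _ gr) => a0 b0 [] /=;
  by rewrite !QE /=; lra.
Qed.

Lemma Q_WSLS_solution (K : realType) (R S T P gamma : K)
    (hRT : T < R) (hRS : S < R) (hSP : P < S) (hgamma1 : gamma < 1) :
  let Q := Q_WSLS R S T P gamma in
  (tie_free_symmetric_solution R S T P gamma Q /\
   Q (C, C) C > Q (C, C) D /\
   Q (C, D) C < Q (C, D) D /\
   Q (D, C) C < Q (D, C) D /\
   Q (D, D) C > Q (D, D) D) <->
  gamma > (S - P) / (R - P).
Proof.
have hRP : 0 < R - P by lra.
rewrite ltr_pdivrMr // => Q.
have QE : Q =2 _ := Q_WSLSE R S T P hgamma1.
move: Q QE => Q QE.
have uE := geometric_rec (R := R) hgamma1.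
(* With [gamma * u] expanded once, the gamma^2 u terms cancel, and the comparison at [(C, D)]
   becomes S - P < gamma (R - P). *)
have guE := congr1 ( *%R gamma) uE; rewrite mulrDr in guE.
split=> [[_ [_ [ltCD _]]]|hgamma].
  by move: ltCD; rewrite !QE /=; lra.
have gr : greedy Q (fun s => if s.1 == s.2 then C else D).
  by move=> [[] []]; rewrite !QE /=; nra.
split; last first.
  by do !split; [exact: (gr (C, C))|exact: (gr (C, D))|exact: (gr (D, C))|
                 exact: (gr (D, D))].
split; first exact: greedy_tie_free gr.
apply/(greedy_bellman _ _ _ _ _ gr) => -[] [] [] /=;
  by rewrite !QE /=; lra.
Qed.

Lemma Q_FH_solution (K : realType) (R S T P gamma : K)
    (hRT : T < R) (hRS : S < R) (hSP : P < S)
    (hgamma0 : 0 <= gamma) (hgamma1 : gamma < 1) :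
  let Q := Q_FH R S T P gamma in
  (tie_free_symmetric_solution R S T P gamma Q /\
   Q (C, C) C < Q (C, C) D /\
   Q (C, D) C < Q (C, D) D /\
   Q (D, C) C < Q (D, C) D /\
   Q (D, D) C > Q (D, D) D) <->
  gamma > (S - P) / (R - S).
Proof.
have hRS' : 0 < R - S by lra.
rewrite ltr_pdivrMr // => Q.
have uE := alternating_rec (R := P) (P := R) hgamma0 hgamma1.
have wE := alternating_rec (R := R) (P := P) hgamma0 hgamma1.
have QE : Q =2 _ := Q_FHE R S T P hgamma0 hgamma1.
move: Q QE uE wE; move: (_ / _) (_ / _) => w u Q QE uE wE.
have dE : (1 + gamma) * (u - w) = R - P by lra.
(* As 1 + gamma > 0, the gain of [D] over [C] at [(C, C)] has the sign of the right-hand side,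
   whence the threshold. *)
have diffE : (1 + gamma) * (w - (S + gamma * w)) = gamma * (R - S) - (S - P).
  have -> : w - (S + gamma * w) = P - S + gamma * (u - w) by lra.
  by rewrite mulrDr mulrCA dE; ring.
have ltE : (S - P < gamma * (R - S)) = (S + gamma * w < w).
  by rewrite -subr_gt0 -diffE pmulr_rgt0 ?subr_gt0 //; lra.
rewrite ltE; split=> [[_ [ltCC _]]|hgamma]; first by move: ltCC; rewrite !QE.
have gr : greedy Q (fun s => if s == (D, D) then C else D).
  by move=> [[] []]; rewrite !QE /=; lra.
split; last first.
  by do !split; [exact: (gr (C, C))|exact: (gr (C, D))|exact: (gr (D, C))|
                 exact: (gr (D, D))].
split; first exact: greedy_tie_free gr.
apply/(greedy_bellman _ _ _ _ _ gr) => -[] [] [] /=;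
  by rewrite !QE /=; lra.
Qed.

Theorem mainTheorem1 (K : realType) (R S T P gamma : K)
    (hRT : T < R) (hTP : P < T) (hRS : S < R) (hSP : P < S)
    (hgamma0 : 0 <= gamma) (hgamma1 : gamma < 1) :
  (forall Q : state -> action -> K,
     tie_free_symmetric_solution R S T P gamma Q ->
     Q =2 Q_allC R S T P gamma \/
     Q =2 Q_WSLS R S T P gamma \/
     Q =2 Q_FH R S T P gamma) /\
  (let Q := Q_allC R S T P gamma in
   tie_free_symmetric_solution R S T P gamma Q /\
   forall a b : action, Q (a, b) C > Q (a, b) D) /\
  (let Q := Q_WSLS R S T P gamma in
   (tie_free_symmetric_solution R S T P gamma Q /\
    Q (C, C) C > Q (C, C) D /\
    Q (C, D) C < Q (C, D) D /\
    Q (D, C) C < Q (D, C) D /\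
    Q (D, D) C > Q (D, D) D) <->
   gamma > (S - P) / (R - P)) /\
  (let Q := Q_FH R S T P gamma in
   (tie_free_symmetric_solution R S T P gamma Q /\
    Q (C, C) C < Q (C, C) D /\
    Q (C, D) C < Q (C, D) D /\
    Q (D, C) C < Q (D, C) D /\
    Q (D, D) C > Q (D, D) D) <->
   gamma > (S - P) / (R - S)).
Proof.
split; last first.
  by split; [exact: Q_allC_solution|
             split; [exact: Q_WSLS_solution|exact: Q_FH_solution]].
move=> Q /(solution_cases hRT hTP hRS hSP hgamma0 hgamma1).
case=> [[u uE QE]|[u uE QE]|[u [w [uE wE QE]]]].
- left => s a; rewrite QE (Q_allCE R S T P hgamma1).
  by rewrite -(geometric_unique hgamma1 uE).
- right; left => s a; rewrite QE (Q_WSLSE R S T P hgamma1).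
  by rewrite -(geometric_unique hgamma1 uE).
- right; right => s a; rewrite QE (Q_FHE R S T P hgamma0 hgamma1).
  by rewrite -(alternating_unique hgamma0 hgamma1 uE wE)
             -(alternating_unique hgamma0 hgamma1 wE uE).
Qed.
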